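(* Let $z_0, z_1, z_2, \ldots$ be independent standard normal random variables, and fix $L \in \mathbb{N}$. For each integer $N \ge L$, let $H_L = H_L(z)$ be the $L \times (N-L+1)$ Hankel matrix \[ H_L(z) = \begin{bmatrix} z_0 & z_1 & \cdots & z_{N-L} \\ z_1 & z_2 & \cdots & z_{N-L+1} \\ \vdots & \vdots & \ddots & \vdots \\ z_{L-1} & z_L & \cdots & z_{N-1} \end{bmatrix}, \] and let $\sigma_{\min}(H_L)$ denote its smallest singular value, i.e. the square root of the smallest eigenvalue of $H_L H_L^\top$. Then there exists a sequence of positive numbers $(\varepsilon_N)$ with $\varepsilon_N \to 0^+$ as $N \to \infty$ such that \[ \lim_{N\to\infty} \Pr\left( \frac{1}{\sigma_{\min}(H_L)} \le \varepsilon_N \right) = 1. \]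
   Context: $H_L(z)$ is the Hankel matrix of depth $L$ built from the first $N$ samples $z_0,\ldots,z_{N-1}$; it has $L$ rows and $N-L+1$ columns, with entry $(i,j)$ equal to $z_{i+j}$ for $0\le i\le L-1$, $0\le j\le N-L$. The convention $1/0=+\infty$ is used if $\sigma_{\min}(H_L)=0$. *)

(* Defs.v *)
From HB Require Import structures.
From mathcomp Require Import all_boot all_order all_algebra.
From mathcomp Require Import all_classical all_reals all_analysis.
Set Implicit Arguments. Unset Strict Implicit. Unset Printing Implicit Defensive.
Import Order.TTheory GRing.Theory Num.Theory.
Import numFieldNormedType.Exports.
Local Open Scope classical_set_scope.
Local Open Scope ring_scope.

(* Mutual independence of a sequence of real random variables: for every
   finite initial segment of indices 0..n-1 and every family of measurable
   sets B, the product rule holds (taking B i = setT covers every finite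
   subfamily). *)
Definition mutually_independent (d : measure_display) (T : measurableType d)
  (R : realType) (P : probability T R) (X : nat -> {RV P >-> R}) : Prop :=
  forall (n : nat) (B : nat -> set R), (forall i, measurable (B i)) ->
    P (\bigcap_(i in `I_n) (X i @^-1` B i)) =
    (\prod_(i < n) P (X i @^-1` B i))%E.

Definition standard_normal (d : measure_display) (T : measurableType d)
  (R : realType) (P : probability T R) (X : {RV P >-> R}) : Prop :=
  forall B : set R, measurable B -> distribution P X B = normal_prob 0 1 B.

Definition hankel (R : Type) (L N : nat) (z : nat -> R) : 'M[R]_(L, N - L + 1) :=
  \matrix_(i < L, j < N - L + 1) z (i + j)%N.

Definition lambda_min (R : realType) (n : nat) (A : 'M[R]_n) : R :=
  inf [set a : R | eigenvalue A a].

Definition sigma_min (R : realType) (m n : nat) (H : 'M[R]_(m, n)) : R :=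
  Num.sqrt (lambda_min (H *m H^T)).

Definition inv_ext (R : realType) (s : R) : \bar R :=
  if s == 0 then +oo%E else (s^-1)%:E.

(* Main.v *)
Require Import Defs.
From HB Require Import structures.
From mathcomp Require Import all_boot all_order all_algebra.
From mathcomp Require Import all_classical all_reals all_analysis.
From mathcomp Require Import ring lra zify.
Import Order.TTheory GRing.Theory Num.Theory.
Import numFieldNormedType.Exports.
Local Open Scope classical_set_scope.
Local Open Scope ring_scope.

(* By the variational characterization, lambda_min (H H^T) is the minimum of
   |x H|^2 over the unit sphere, so a few well-chosen columns of H suffice to
   bound it from below. Cut the samples into disjoint blocks of length 2L-1.
   If in some block the middle sample lies in [K, K+1] and the others in
   [0, 1], the corresponding L columns form a nearly anti-diagonal matrix, and
   lambda_min >= (K - L)^2 / L. Each block does so with the same positive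
   probability p, independently of the others, so the probability that none of
   m blocks does is (1 - p)^m. Hence sigma_min exceeds any given level with
   probability tending to 1, and a diagonal argument provides eps. *)

(** * Squared norm of row vectors and its continuity *)

Definition sqnorm {R : realType} {n : nat} (v : 'rV[R]_n) : R :=
  \sum_(i < n) v 0 i ^+ 2.

Lemma sqnorm_ge0 {R : realType} {n : nat} (v : 'rV[R]_n) : 0 <= sqnorm v.
Proof. by apply: sumr_ge0 => i _; exact: sqr_ge0. Qed.

Lemma sqnorm_eq0 {R : realType} {n : nat} (v : 'rV[R]_n) :
  (sqnorm v == 0) = (v == 0).
Proof.
rewrite /sqnorm psumr_eq0 => [|i _]; last exact: sqr_ge0.
apply/allP/eqP => [v0|-> i _]; last by rewrite mxE expr0n eqxx.
apply/rowP => i; rewrite mxE; apply/eqP.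
by have := v0 i (mem_index_enum _); rewrite sqrf_eq0.
Qed.

Lemma sqnormZ {R : realType} {n : nat} (a : R) (v : 'rV[R]_n) :
  sqnorm (a *: v) = a ^+ 2 * sqnorm v.
Proof. by rewrite mulr_sumr; apply: eq_bigr => i _; rewrite mxE exprMn. Qed.

Lemma dot_sqnorm {R : realType} {n : nat} (v : 'rV[R]_n) :
  (v *m v^T) 0 0 = sqnorm v.
Proof. by rewrite mxE; apply: eq_bigr => i _; rewrite mxE. Qed.

Lemma sqnormD {R : realType} {n : nat} (u v : 'rV[R]_n) (t : R) :
  sqnorm (u + t *: v) =
  sqnorm u + t * (u *m v^T) 0 0 *+ 2 + t ^+ 2 * sqnorm v.
Proof.
rewrite /sqnorm mxE !mulr_sumr -sumrMnl -!big_split /=.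
by apply: eq_bigr => i _; rewrite !mxE; ring.
Qed.

Lemma cvg_sum {R : realType} {T : Type} {F : set_system T} {FF : Filter F}
    {I : Type} (s : seq I) (f : I -> T -> R) (l : I -> R) :
  (forall i, f i @ F --> l i) ->
  (fun t => \sum_(i <- s) f i t) @ F --> \sum_(i <- s) l i.
Proof.
move=> fl; elim: s => [|i s IH].
  by under eq_fun do rewrite big_nil; rewrite big_nil; exact: cvg_cst.
under eq_fun do rewrite big_cons.
by rewrite big_cons; apply: cvgD.
Qed.

(** The filter is arbitrary so that one statement yields both continuity at a point and limits along
    approximating sequences. *)
Lemma cvg_sqnorm_mulmx {R : realType} {T : Type} {F : set_system T}
    {FF : Filter F} {m n : nat} (H : 'M[R]_(m, n)) (u : T -> 'rV[R]_m)
    (l : 'rV[R]_m) :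
  (forall i, (fun t => u t 0 i) @ F --> l 0 i) ->
  (fun t => sqnorm (u t *m H)) @ F --> sqnorm (l *m H).
Proof.
move=> ul; apply: cvg_sum => j.
under eq_fun do rewrite expr2 mxE.
rewrite expr2 mxE.
have S : (fun t => \sum_i u t 0 i * H i j) @ F --> \sum_i l 0 i * H i j.
  by apply: cvg_sum => i; apply: cvgM; [exact: ul|exact: cvg_cst].
exact: cvgM.
Qed.

Lemma cvg_sqnorm {R : realType} {T : Type} {F : set_system T}
    {FF : Filter F} {m : nat} (u : T -> 'rV[R]_m) (l : 'rV[R]_m) :
  (forall i, (fun t => u t 0 i) @ F --> l 0 i) ->
  (fun t => sqnorm (u t)) @ F --> sqnorm l.
Proof.
move=> /(cvg_sqnorm_mulmx 1%:M).
by under eq_fun do rewrite mulmx1; rewrite mulmx1.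
Qed.

Lemma continuous_sqnorm_mulmx {R : realType} {m n : nat} (H : 'M[R]_(m, n)) :
  continuous (fun x : 'rV[R]_m => sqnorm (x *m H)).
Proof.
move=> x; have coord i : (fun t : 'rV[R]_m => t 0 i) @ x --> x 0 i.
  exact: (@coord_continuous R 1 m 0 i x).
exact: (cvg_sqnorm_mulmx H id x coord).
Qed.

Lemma continuous_sqnorm {R : realType} {m : nat} :
  continuous (@sqnorm R m).
Proof.
rewrite (_ : sqnorm = fun x : 'rV[R]_m => sqnorm (x *m 1%:M)).
  exact: continuous_sqnorm_mulmx.
by apply/funext => x; rewrite mulmx1.
Qed.

(** * Variational characterization of the smallest eigenvalue *)

(** The unit sphere is compact, being closed in the cube [[-1, 1]^(m+1)], so a minimizer exists;
    homogeneity of degree 2 extends the bound to all [y]. *)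
Lemma sqnorm_mulmx_min {R : realType} {m n : nat} (H : 'M[R]_(m.+1, n)) :
  exists2 x : 'rV[R]_m.+1, sqnorm x = 1 &
    forall y : 'rV[R]_m.+1, sqnorm (x *m H) * sqnorm y <= sqnorm (y *m H).
Proof.
pose S := [set x : 'rV[R]_m.+1 | sqnorm x = 1].
have S0 : S !=set0.
  exists (delta_mx 0 0); rewrite /S /= /sqnorm (bigD1 ord0)//= big1 => [|i i0].
    by rewrite mxE !eqxx expr1n addr0.
  by rewrite mxE (negbTE i0) andbF expr0n.
have cS : compact S.
  apply: (@subclosed_compact _ _
    [set v : 'rV[R]_m.+1 | forall i, `[(- 1 : R), 1]%classic (v ord0 i)]).
  - rewrite (_ : S = (@sqnorm R m.+1) @^-1` [set 1]) //.
    apply: preimage_closed; last exact: closed_eq.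
    by move=> x _; exact: continuous_sqnorm.
  - apply: (@rV_compact R _ (fun=> `[(- 1 : R), 1]%classic)) => _.
    exact: segment_compact.
  - move=> v; rewrite /S /sqnorm /= => v1 i; rewrite in_itv /= -ler_norml.
    rewrite -(@expr_le1 _ 2)// real_normK ?num_real//.
    rewrite -v1 (bigD1 i)//= lerDl.
    by apply: sumr_ge0 => j _; exact: sqr_ge0.
have [x xS xmin] : exists2 c, c \in S &
    forall t, t \in S -> sqnorm (c *m H) <= sqnorm (t *m H).
  apply: compact_EVT_min => //; apply: continuous_subspaceT.
  exact: continuous_sqnorm_mulmx.
exists x => [|y]; first by move: xS; rewrite inE.
have [->|y0] := eqVneq y 0.
  rewrite mul0mx; suff -> : sqnorm (0 : 'rV[R]_m.+1) = 0 by rewrite mulr0 sqnorm_ge0.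
  by apply/eqP; rewrite sqnorm_eq0.
have ny : 0 < sqnorm y by rewrite lt_def sqnorm_eq0 y0 sqnorm_ge0.
rewrite -ler_pdivlMr//.
have sq : (Num.sqrt (sqnorm y))^-1 ^+ 2 = (sqnorm y)^-1.
  by rewrite exprVn sqr_sqrtr// ltW.
have := xmin ((Num.sqrt (sqnorm y))^-1 *: y).
rewrite -scalemxAl !sqnormZ sq mulrC; apply.
by rewrite inE /S /= sqnormZ sq mulVf// gt_eqF.
Qed.

(* First-order optimality: a quadratic in t that is nonnegative and vanishes at
   0 has no linear term. *)
Lemma linear_coef_eq0 {R : realType} (b g : R) :
  (forall t, 0 <= t * b *+ 2 + t ^+ 2 * g) -> b = 0.
Proof.
move=> H; apply/eqP; apply: contraT => b0.
have b2 : 0 < b ^+ 2 by rewrite lt_def sqrf_eq0 b0 sqr_ge0.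
have g0 : 0 <= g.
  by have := H 1; have := H (-1); rewrite !expr2; lra.
have g1 : 0 < g + 1 by lra.
(* For [b != 0] the quadratic is negative at this [t]; the denominator [g + 1] stays positive even
   when [g = 0]. *)
have := H (- b / (g + 1)).
rewrite (_ : _ + _ = - (b ^+ 2 * (g + 2)) / (g + 1) ^+ 2); last first.
  by field; rewrite gt_eqF.
rewrite pmulr_lge0 ?invr_gt0 ?exprn_gt0// oppr_ge0 leNgt mulr_gt0//; lra.
Qed.

(** Vary [x] in the direction of the residual [y = x H H^T - mu x]: the linear coefficient in [t] is
    [sqnorm y], so minimality forces [y = 0]. *)
Lemma eigenvalue_sqnorm_min {R : realType} {m n : nat} (H : 'M[R]_(m, n))
    (x : 'rV[R]_m) : sqnorm x = 1 ->
  (forall y : 'rV[R]_m, sqnorm (x *m H) * sqnorm y <= sqnorm (y *m H)) ->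
  eigenvalue (H *m H^T) (sqnorm (x *m H)).
Proof.
move=> x1 xmin; apply/eigenvalueP; exists x; last first.
  by rewrite -sqnorm_eq0 x1 oner_eq0.
set mu := sqnorm (x *m H) in xmin *.
pose y := x *m (H *m H^T) - mu *: x.
apply/eqP; rewrite -subr_eq0 -/y -sqnorm_eq0 -dot_sqnorm {1}/y mulmxBl.
rewrite -scalemxAl !mxE; apply/eqP.
have -> : \sum_j (x *m (H *m H^T)) 0 j * y^T j 0
    = ((x *m H) *m (y *m H)^T) 0 0.
  by rewrite trmx_mul !mulmxA [RHS]mxE.
have -> : \sum_j x 0 j * y^T j 0 = (x *m y^T) 0 0 by rewrite mxE.
apply: (@linear_coef_eq0 _ _ (sqnorm (y *m H) - mu * sqnorm y)) => t.
have := xmin (x + t *: y).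
rewrite mulmxDl -scalemxAl !sqnormD x1 -/mu -subr_ge0.
by congr (0 <= _); ring.
Qed.

(** The eigenvalues are bounded below by 0 and include the minimum over the sphere, so [inf] is a
    genuine infimum here and not a default value. *)
Lemma lambda_min_ge {R : realType} {m n : nat} (H : 'M[R]_(m.+1, n)) (c : R) :
  (c <= lambda_min (H *m H^T)) <->
  (forall y : 'rV[R]_m.+1, c * sqnorm y <= sqnorm (y *m H)).
Proof.
have eigE (a : R) (v : 'rV[R]_m.+1) :
    v *m (H *m H^T) = a *: v -> sqnorm (v *m H) = a * sqnorm v.
  by move=> va; rewrite -!dot_sqnorm trmx_mul !mulmxA -(mulmxA v) va -scalemxAl mxE.
have [x x1 xmin] := sqnorm_mulmx_min H.
have xe := eigenvalue_sqnorm_min H x x1 xmin.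
split=> [cl y|cH].
  apply: le_trans (xmin y); apply: ler_wpM2r; first exact: sqnorm_ge0.
  apply: le_trans cl _; apply: ge_inf => //=.
  exists 0 => a /= /eigenvalueP[v va v0].
  have v1 : 0 < sqnorm v by rewrite lt_def sqnorm_eq0 v0 sqnorm_ge0.
  by rewrite -(pmulr_lge0 _ v1) -(eigE _ _ va) sqnorm_ge0.
apply: lb_le_inf; first by exists (sqnorm (x *m H)).
move=> a /= /eigenvalueP[v va v0].
have v1 : 0 < sqnorm v by rewrite lt_def sqnorm_eq0 v0 sqnorm_ge0.
by rewrite -(ler_pM2r v1) -(eigE _ _ va).
Qed.

(** * Countable reduction and measurability of the eigenvalue events *)

Lemma cvg_floor_approx {R : realType} (x : R) :
  (fun k : nat => k.+1%:R^-1 * (Num.floor (k.+1%:R * x))%:~R : R) @ \oo --> x.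
Proof.
apply: (@squeeze_cvgr _ _ _ _ (fun k => x - harmonic k) (fun=> x)).
- apply: nearW => k; rewrite /harmonic /= [k.+1%:R^-1 * _]mulrC.
  have k0 : 0 < k.+1%:R :> R by rewrite ltr0n.
  rewrite ler_pdivlMr// ler_pdivrMr// mulrBl mulVf ?gt_eqF// [x * _]mulrC.
  rewrite floor_le_tmp andbT.
  have := floorD1_gt (k.+1%:R * x); rewrite intrD; lra.
- by rewrite -[X in _ --> X]subr0; apply: cvgB; [exact: cvg_cst|exact: cvg_harmonic].
- exact: cvg_cst.
Qed.

(* Reduces the quantifier over real vectors to a countable one, which makes the
   event {c <= lambda_min} measurable. *)
Lemma sqnorm_ge_int {R : realType} {m n : nat} (H : 'M[R]_(m, n)) (c : R) :
  (forall y : 'rV[int]_m,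
     c * sqnorm (map_mx intr y : 'rV[R]_m) <= sqnorm (map_mx intr y *m H)) ->
  forall y : 'rV[R]_m, c * sqnorm y <= sqnorm (y *m H).
Proof.
move=> cH y.
(* An integer vector divided by [k + 1]: both sides of the inequality scale by the same square, so
   it holds for [u k] and passes to the limit [y]. *)
pose u (k : nat) : 'rV[R]_m :=
  k.+1%:R^-1 *: map_mx intr (\row_i Num.floor (k.+1%:R * y 0 i)).
have uy i : (fun k => u k 0 i) @ \oo --> y 0 i.
  by under eq_fun do rewrite !mxE; exact: cvg_floor_approx.
have lim : (fun k => sqnorm (u k *m H) - c * sqnorm (u k)) @ \oo
    --> sqnorm (y *m H) - c * sqnorm y.
  apply: cvgB; first exact: cvg_sqnorm_mulmx.
  by apply: cvgM; [exact: cvg_cst|exact: cvg_sqnorm].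
rewrite -subr_ge0 -(cvg_lim _ lim)//.
apply: limr_ge; first by apply/cvg_ex; eexists; exact: lim.
apply: nearW => k; rewrite subr_ge0 /u -scalemxAl !sqnormZ mulrCA.
by apply: ler_wpM2l; [exact: sqr_ge0|exact: cH].
Qed.

(** [Num.sqrt] vanishes exactly on nonpositive reals, so the infinite branch means
    [lambda_min <= 0], and there both sides are false. *)
Lemma inv_ext_sigma_min_le {R : realType} {m n : nat} (H : 'M[R]_(m, n))
    (e : R) : 0 < e ->
  (inv_ext (sigma_min H) <= e%:E)%E = (e ^- 2 <= lambda_min (H *m H^T)).
Proof.
move=> e0; rewrite /inv_ext /sigma_min; set l := lambda_min _.
have e2 : 0 < e ^- 2 by rewrite invr_gt0 exprn_gt0.
case: ifPn => [|s0].
  rewrite sqrtr_eq0 leye_eq /= => l0.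
  by apply/esym/negbTE; rewrite -ltNge (le_lt_trans l0).
have l0 : 0 < l by rewrite sqrtr_eq0 -ltNge in s0.
rewrite lee_fin invf_ple ?posrE ?sqrtr_gt0// -ler_sqr ?nnegrE ?sqrtr_ge0//.
  by rewrite (sqr_sqrtr (ltW l0)) exprVn.
by rewrite invr_ge0 ltW.
Qed.

Lemma measurable_lambda_min_ge {d : measure_display} {T : measurableType d}
    {R : realType} {m n : nat} (H : T -> 'M[R]_(m.+1, n)) (c : R) :
  (forall i j, measurable_fun setT (fun w => H w i j)) ->
  measurable [set w | c <= lambda_min (H w *m (H w)^T)].
Proof.
move=> mH.
pose G (y : 'rV[int]_m.+1) : set T :=
  [set w | c * sqnorm (map_mx intr y : 'rV[R]_m.+1)
           <= sqnorm (map_mx intr y *m H w)].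
rewrite (_ : [set _ | _] = ~` \bigcup_y ~` G y); last first.
  apply/seteqP; split=> w /=; rewrite lambda_min_ge.
    by move=> cw [y _]; apply; exact: cw.
  move=> Gw; apply: sqnorm_ge_int => y; apply: contrapT => nG.
  by apply: Gw; exists y.
apply: measurableC; apply: countable_bigcupT_measurable => [|y].
  exact: countableP.
apply: measurableC.
have mf : measurable_fun setT (fun w => sqnorm (map_mx intr y *m H w)).
  apply: measurable_sum => j; apply: measurable_realfun.measurable_funX.
  under eq_fun do rewrite mxE.
  by apply: measurable_sum => i; apply: measurable_realfun.measurable_funM.
rewrite (_ : G y = (fun w => sqnorm (map_mx intr y *m H w)) @^-1`
    `[c * sqnorm (map_mx intr y : 'rV[R]_m.+1), +oo[%classic).
  by rewrite -[_ @^-1` _]setTI; apply: mf.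
by apply/seteqP; split=> w; rewrite /G /= in_itv /= andbT.
Qed.

(** * Deterministic bound from one favourable block *)

(** If [M] is the largest [|x_i|], some column pairs it with the middle sample: that term is at
    least [a M], the others total at most [(L+1) M], and [sqnorm x <= (L+1) M^2]. *)
Lemma sqnorm_mulmx_hankel_block {R : realType} {L N : nat} (z : nat -> R)
    (a : R) (s : nat) :
  L.+1%:R <= a -> (s + L < N - L.+1 + 1)%N ->
  (forall i, (i < L.*2.+1)%N -> 0 <= z (s + i)%N /\
     (if i == L then a <= z (s + i)%N else z (s + i)%N <= 1)) ->
  forall x : 'rV[R]_L.+1,
    (a - L.+1%:R) ^+ 2 / L.+1%:R * sqnorm x <= sqnorm (x *m hankel L.+1 N z).
Proof.
move=> La sN hz x.
have [i0 _ imax] : exists2 i0 : 'I_L.+1, true &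
    forall i, `|x 0 i| <= `|x 0 i0|.
  exists [arg max_(i > ord0) `|x 0 i|]%O => //.
  by case: Order.TotalTheory.arg_maxP => // i _ H k; exact: H.
set M := `|x 0 i0| in imax.
have xM : sqnorm x <= L.+1%:R * M ^+ 2.
  apply: (@le_trans _ _ (\sum_(i < L.+1) M ^+ 2)).
    apply: ler_sum => i _; rewrite -real_normK ?num_real//.
    by rewrite ler_sqr ?nnegrE ?imax// normr_ge0.
  by rewrite sumr_const card_ord mulr_natl.
(* Column j is the one whose middle sample multiplies the largest entry of x. *)
have jN : (s + (L - i0) < N - L.+1 + 1)%N by lia.
pose j := Ordinal jN.
have jle : (a - L.+1%:R) * M <= `|(x *m hankel L.+1 N z) 0 j|.
  rewrite mxE (bigD1 i0)//=; set S := \sum_(_ | _) _.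
  have SM : `|S| <= L.+1%:R * M.
    apply: le_trans (ler_norm_sum _ _ _) _.
    apply: (@le_trans _ _ (\sum_(i < L.+1) M)); last first.
      by rewrite sumr_const card_ord mulr_natl.
    rewrite big_mkcond /=; apply: ler_sum => i _; case: ifPn => [ii0|_]; last first.
      exact: normr_ge0.
    rewrite normrM mxE /=.
    (* Row [i] of column [j] is at offset [i + (L - i0)] in the block, which is the middle only for
       [i = i0]. *)
    have -> : (i + (s + (L - i0)) = s + (i + (L - i0)))%N by lia.
    have := hz (i + (L - i0))%N.
    have -> : (i + (L - i0) == L)%N = false.
      apply/negbTE; apply: contra ii0 => /eqP e; apply/eqP/val_inj => /=.
      by have := ltn_ord i0; lia.
    move=> /(_ _)[|z0 z1]; first by have := ltn_ord i; lia.
    rewrite (ger0_norm z0); apply: le_trans (imax i).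
    by rewrite ler_piMr.
  have : a * M <= `|x 0 i0 * hankel L.+1 N z i0 j|.
    rewrite normrM mxE /= mulrC ler_wpM2l ?normr_ge0//.
    have -> : (i0 + (s + (L - i0)) = s + L)%N by have := ltn_ord i0; lia.
    have [|_] := hz L; first by lia.
    by rewrite eqxx => /le_trans; apply; exact: ler_norm.
  have := lerB_normD (x 0 i0 * hankel L.+1 N z i0 j) S.
  by rewrite mulrBl; lra.
apply: (@le_trans _ _ (((a - L.+1%:R) * M) ^+ 2)).
  rewrite exprMn -mulrA ler_wpM2l ?sqr_ge0// mulrC ler_pdivrMr ?ltr0n//.
  by rewrite mulrC.
apply: (@le_trans _ _ (`|(x *m hankel L.+1 N z) 0 j| ^+ 2)).
  by rewrite ler_sqr// nnegrE ?mulr_ge0 ?subr_ge0 ?normr_ge0.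
rewrite real_normK ?num_real// [leRHS](bigD1 j)//= lerDl.
by apply: sumr_ge0 => k _; exact: sqr_ge0.
Qed.

(** * Independence of events on disjoint sets of indices *)

(** Every constraint is spread over the whole segment [0..n-1], with [setT] at free indices, to
    match the form of [mutually_independent]. *)
Definition box {d : measure_display} {T : measurableType d} {R : realType}
    {P : probability T R} (z : nat -> {RV P >-> R}) (n : nat)
    (B : nat -> set R) : set T :=
  \bigcap_(i in `I_n) (z i @^-1` B i).

Lemma measurable_box {d : measure_display} {T : measurableType d}
    {R : realType} {P : probability T R} (z : nat -> {RV P >-> R}) (n : nat)
    (B : nat -> set R) :
  (forall i, measurable (B i)) -> measurable (box z n B).
Proof.
move=> mB; apply: fin_bigcap_measurable; first exact: finite_II.
by move=> i _; apply: measurable_funPTI.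
Qed.

Lemma boxI {d : measure_display} {T : measurableType d} {R : realType}
    {P : probability T R} (z : nat -> {RV P >-> R}) (n : nat)
    (B C : nat -> set R) :
  box z n (fun i => B i `&` C i) = box z n B `&` box z n C.
Proof. by rewrite /box -bigcapI. Qed.

Lemma fine_prob_box {d : measure_display} {T : measurableType d}
    {R : realType} {P : probability T R} (z : nat -> {RV P >-> R}) (n : nat)
    (B : nat -> set R) :
  mutually_independent z -> (forall i, measurable (B i)) ->
  fine (P (box z n B)) = \prod_(i < n) fine (P (z i @^-1` B i)).
Proof.
move=> zI mB; rewrite /box zI//.
rewrite (eq_bigr (fun i : 'I_n => (fine (P (z i @^-1` B i)))%:E)).
  by rewrite prodEFin.
move=> i _; rewrite fineK// fin_num_measure//.
exact: measurable_funPTI.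
Qed.

(** At each index one of the two sets is [setT], so the product formula splits factor by factor. *)
Lemma fine_prob_boxI {d : measure_display} {T : measurableType d}
    {R : realType} {P : probability T R} (z : nat -> {RV P >-> R}) (n : nat)
    (B C : nat -> set R) :
  mutually_independent z ->
  (forall i, measurable (B i)) -> (forall i, measurable (C i)) ->
  (forall i, B i = setT \/ C i = setT) ->
  fine (P (box z n B `&` box z n C)) =
  fine (P (box z n B)) * fine (P (box z n C)).
Proof.
move=> zI mB mC BC; rewrite -boxI !fine_prob_box//; last first.
  by move=> i; exact: measurableI.
rewrite -big_split /=; apply: eq_bigr => i _.
have [->|->] := BC i.
  by rewrite setTI preimage_setT probability_setT mul1r.
by rewrite setIT preimage_setT probability_setT mulr1.
Qed.

(* The extra box B carries the induction on m: removing the event of index m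
   replaces B by its intersection with C m. *)
Lemma fine_prob_boxI_none {d : measure_display} {T : measurableType d}
    {R : realType} {P : probability T R} (z : nat -> {RV P >-> R}) (n : nat)
    (C : nat -> nat -> set R) :
  mutually_independent z -> (forall b i, measurable (C b i)) ->
  (forall b b' i, b <> b' -> C b i = setT \/ C b' i = setT) ->
  forall m (B : nat -> set R), (forall i, measurable (B i)) ->
  (forall b i, (b < m)%N -> B i = setT \/ C b i = setT) ->
  fine (P (box z n B `&` \bigcap_(b in `I_m) ~` box z n (C b))) =
  fine (P (box z n B)) * \prod_(b < m) (1 - fine (P (box z n (C b)))).
Proof.
move=> zI mC CC; elim=> [|m IH] B mB BC.
  by rewrite II0 bigcap_set0 setIT big_ord0 mulr1.
pose F B := box z n B `&` \bigcap_(b in `I_m) ~` box z n (C b).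
have mF B' : (forall i, measurable (B' i)) -> measurable (F B').
  move=> mB'; apply: measurableI; first exact: measurable_box.
  apply: fin_bigcap_measurable; first exact: finite_II.
  by move=> b _; apply: measurableC; exact: measurable_box.
pose B' i := B i `&` C m i.
have mB' i : measurable (B' i) by exact: measurableI.
have -> : box z n B `&` \bigcap_(b in `I_m.+1) ~` box z n (C b) = F B `\` F B'.
  rewrite /F boxI; apply/seteqP; split=> w /=.
    move=> [Bw Cw]; split; first by split=> // b bm; apply: Cw => /=; exact: ltnW.
    by move=> [[_ Cm] _]; apply: (Cw m) => /=.
  move=> [[Bw Cw] nw]; split=> // b /=; rewrite ltnS leq_eqVlt => /orP[/eqP->|].
    by move=> Cm; apply: nw.
  by move=> bm; exact: Cw.
rewrite measureD; [|exact: mF|exact: mF|]; last first.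
  by rewrite ltey_eq fin_num_measure//; exact: mF.
have -> : F B `&` F B' = F B'.
  by apply/setIidPr => w; rewrite /F boxI => -[[]].
rewrite fineB ?fin_num_measure//; [|exact: mF|exact: mF].
rewrite IH//; last by move=> b i bm; apply: BC; exact: ltnW.
(* [B'] constrains only indices used by [B] or by [C m], both free of the constraints of [C b] for
   [b < m]. *)
rewrite IH//; last first.
  move=> b i bm; have [Bi|->] := BC b i (ltnW bm); last by right.
  have mb : m <> b by move=> e; rewrite e ltnn in bm.
  have [Cm|->] := CC m b i mb; last by right.
  by left; rewrite /B' Bi Cm setIT.
rewrite /B' boxI fine_prob_boxI//; last by move=> i; exact: BC.
by rewrite big_ord_recr /=; ring.
Qed.

(** * Positivity of Gaussian probabilities *)

(** On [[a, a + 1]] with [a >= 0] the density is at least its value [c] at the right endpoint, and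
    the segment has length 1. *)
Lemma normal_prob_segment_gt0 {R : realType} (a : R) : 0 <= a ->
  (0 < normal_prob 0 1 `[a, (a + 1)%R]%classic)%E.
Proof.
move=> a0.
pose c : R := normal_peak 1 * expR (- (a + 1) ^+ 2 / 2).
have c0 : 0 < c by rewrite mulr_gt0 ?expR_gt0// normal_peak_gt0.
have mI : measurable `[a, a + 1] by exact: measurable_itv.
apply: (@lt_le_trans _ _ (\int[lebesgue_measure]_(x in `[a, (a + 1)%R]) (cst c%:E x))%E).
  rewrite integral_cst// [X in (_ * X)%E](_ : _ = 1%E) ?mule1 ?lte_fin//.
  apply: etrans (lebesgue_measure_itv `[a, (a + 1)%R]) _.
  by rewrite /= lte_fin ltrDl ltr01 -EFinD addrAC subrr add0r.
apply: ge0_le_integral => //.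
- by move=> x _; rewrite lee_fin ltW.
- apply/measurable_realfun.measurable_EFinP; apply: measurable_funTS.
  exact: measurable_normal_pdf.
- move=> x /=; rewrite in_itv /= => /andP[ax xa1].
  rewrite lee_fin normal_pdfE// /c /normal_fun subr0 expr1n.
  rewrite ler_wpM2l ?normal_peak_ge0// ler_expR !mulNr lerN2.
  rewrite ler_pM2r ?invr_gt0// ler_sqr ?nnegrE//; lra.
Qed.

(** * Diagonal argument *)

(** Take [eps N = 1/(k+1)] for the largest [k <= N] whose threshold [n_ k] has been passed at
    [N]. *)
Lemma cvg_diagonal {R : realType} (p : R -> nat -> R) :
  (forall e N, 0 < e -> p e N <= 1) ->
  (forall e : R, 0 < e -> p e @ \oo --> (1 : R)) ->
  exists eps : nat -> R, [/\ forall N, 0 < eps N, eps @ \oo --> (0 : R) &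
    (fun N => p (eps N) N) @ \oo --> (1 : R)].
Proof.
move=> p1 pc.
pose e (k : nat) : R := harmonic k.
have e0 k : 0 < e k by rewrite /e /harmonic /= invr_gt0 ltr0n.
have /choice[n_ hn] : forall k, exists n0, forall N, (n0 <= N)%N ->
    1 - e k <= p (e k) N.
  move=> k; have [|n0 _ H] := cvgr_ge _ (pc (e k) (e0 k)) (1 - e k).
    by rewrite ltrBlDr ltrDl.
  by exists n0 => N; exact: H.
(* An empty maximum is 0, so the threshold property of [kap N] is claimed only once [n_ 0 <= N]. *)
pose kap (N : nat) : nat := \max_(k < N.+1 | (n_ k <= N)%N) k.
have kapP N : (n_ 0 <= N)%N -> (n_ (kap N) <= N)%N.
  move=> n0N.
  have [i nP iE] : {i : 'I_N.+1 | (n_ i <= N)%N & kap N = i}.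
    by apply: eq_bigmax_cond; apply/card_gt0P; exists ord0.
  by rewrite iE.
have kap_ge k : \forall N \near \oo, (k <= kap N)%N.
  exists (maxn k (n_ k)) => // N /=; rewrite geq_max => /andP[kN nN].
  have kN1 : (k < N.+1)%N by [].
  exact: (@leq_bigmax_cond _ (fun i : 'I_N.+1 => (n_ i <= N)%N)
    (fun i => nat_of_ord i) (Ordinal kN1)).
have ekap : (fun N => e (kap N)) @ \oo --> (0 : R).
  apply: (@cvg_comp _ _ _ kap e _ \oo); last exact: cvg_harmonic.
  by move=> A [k _ kA]; near=> N; apply: kA => /=; near: N; exact: kap_ge.
exists (fun N => e (kap N)); split => //.
apply: (@squeeze_cvgr _ _ _ _ (fun N => 1 - e (kap N)) (fun=> 1)).
- near=> N; rewrite p1 ?e0// andbT; apply: hn; apply: kapP.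
  by near: N; exact: nbhs_infty_ge.
- by rewrite -[X in _ --> X]subr0; apply: cvgB; [exact: cvg_cst|exact: ekap].
- exact: cvg_cst.
Unshelve. all: by end_near.
Qed.

(** * Block events and their probabilities *)

(* For matrices with L.+1 rows a block has
   2 L + 1 samples and its middle one has index L. *)
Definition block_set {R : realType} (L : nat) (a : R) (i : nat) : set R :=
  if i == L then `[a, a + 1]%classic else `[0, 0 + 1]%classic.

Definition block_event_set {R : realType} (L : nat) (a : R) (b i : nat)
    : set R :=
  if (b * L.*2.+1 <= i < b.+1 * L.*2.+1)%N
  then block_set L a (i - b * L.*2.+1) else setT.

Lemma measurable_block_event_set {R : realType} (L : nat) (a : R) (b i : nat) :
  measurable (block_event_set L a b i).
Proof.
by rewrite /block_event_set /block_set; do 2?case: ifP => _ //;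
  exact: measurable_itv.
Qed.

Lemma block_event_set_disj {R : realType} (L : nat) (a : R) (b b' i : nat) :
  b <> b' -> block_event_set L a b i = setT \/ block_event_set L a b' i = setT.
Proof.
move=> bb'; rewrite /block_event_set.
case: ifPn => [/andP[b1 b2]|_]; last by left.
case: ifPn => [/andP[b3 b4]|_]; last by right.
exfalso; apply: bb'.
have := leq_ltn_trans b1 b4; have := leq_ltn_trans b3 b2.
by rewrite !ltn_pmul2r// !ltnS => ? ?; apply/eqP; rewrite eqn_leq; apply/andP.
Qed.

(** Indices outside block [b] contribute factors 1, and identical distribution moves the others to
    [0..2L]; the value depends on neither [b] nor [m]. *)
Lemma fine_prob_block {d : measure_display} {T : measurableType d}
    {R : realType} {P : probability T R} (z : nat -> {RV P >-> R}) (L : nat)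
    (a : R) (m b : nat) :
  mutually_independent z -> (forall i, standard_normal (z i)) -> (b < m)%N ->
  fine (P (box z (m * L.*2.+1) (block_event_set L a b))) =
  \prod_(i < L.*2.+1) fine (normal_prob 0 1 (block_set L a i)).
Proof.
move=> zI zN bm; rewrite fine_prob_box//; last first.
  exact: measurable_block_event_set.
pose f i := fine (P (z i @^-1` block_event_set L a b i)).
rewrite -(big_mkord xpredT f) /=.
have bm1 : (b * L.*2.+1 <= m * L.*2.+1)%N by rewrite leq_mul2r ltnW ?orbT.
have bm2 : (b.+1 * L.*2.+1 <= m * L.*2.+1)%N by rewrite leq_mul2r bm orbT.
have fT i : (b * L.*2.+1 <= i < b.+1 * L.*2.+1)%N = false -> f i = 1.
  by move=> E; rewrite /f /block_event_set E preimage_setT probability_setT.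
rewrite (big_cat_nat (n := b * L.*2.+1))//=.
rewrite (big_cat_nat (n := b.+1 * L.*2.+1) (m := b * L.*2.+1))//=; last first.
  by rewrite leq_mul2r leqnSn orbT.
rewrite big_nat_cond big1 ?mul1r => [|i]; last first.
  by rewrite andbT => /andP[_ ib]; apply: fT; rewrite leqNgt ib.
rewrite [X in _ * X]big_nat_cond [X in _ * X]big1 ?mulr1 => [|i]; last first.
  by rewrite andbT => /andP[ib _]; apply: fT; rewrite [X in _ && X]ltnNge ib andbF.
rewrite -{1}[(b * _)%N]add0n big_addn mulSn addnK big_mkord.
apply: eq_bigr => i _.
rewrite /f /block_event_set leq_addl mulSn ltn_add2r ltn_ord /= addnK.
congr fine; apply: zN.
by rewrite /block_set; case: ifP => _; exact: measurable_itv.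
Qed.

Lemma block_prob_gt0 {R : realType} (L : nat) (a : R) : 0 <= a ->
  0 < \prod_(i < L.*2.+1) fine (normal_prob 0 1 (block_set L a i)).
Proof.
move=> a0; apply: prodr_gt0 => i _.
have mB : measurable (block_set L a i).
  by rewrite /block_set; case: ifP => _; exact: measurable_itv.
apply: fine_gt0; apply/andP; split.
  by rewrite /block_set; case: ifP => _; exact: normal_prob_segment_gt0.
by rewrite ltey_eq fin_num_measure.
Qed.

(** The level [K = (L+1)(a+1)] gives [K - (L+1) = (L+1) a], so the block bound is
    [(L+1) a^2 >= a^2]. *)
Lemma lambda_min_hankel_block {R : realType} {L N m b : nat} (z : nat -> R)
    (a : R) : 0 < a -> (b < m)%N -> (m.+1 * L.*2.+1 <= N)%N ->
  (forall i, (i < m * L.*2.+1)%N ->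
     block_event_set L (L.+1%:R * (a + 1)) b i (z i)) ->
  a ^+ 2 <= lambda_min (hankel L.+1 N z *m (hankel L.+1 N z)^T).
Proof.
move=> a0 bm mN hz; apply/lambda_min_ge => y.
set K := L.+1%:R * (a + 1) in hz.
have L1 : 1 <= L.+1%:R :> R by rewrite ler1n.
have LK : L.+1%:R <= K by rewrite /K; nra.
have bmul : (b.+1 * L.*2.+1 <= m * L.*2.+1)%N by rewrite leq_mul2r bm orbT.
apply: (le_trans _ (@sqnorm_mulmx_hankel_block _ L N z K (b * L.*2.+1) LK _ _ y)).
- apply: ler_wpM2r; first exact: sqnorm_ge0.
  rewrite ler_pdivlMr ?ltr0n// /K.
  rewrite (_ : _ - _ = L.+1%:R * a); last by ring.
  rewrite exprMn mulrC ler_wpM2r ?sqr_ge0// expr2.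
  by rewrite ler_peMl ?ler0n ?ler1n.
- move: bmul mN; rewrite !mulSn -!mul2n; lia.
- move=> i iL.
  have im : (b * L.*2.+1 + i < m * L.*2.+1)%N by move: bmul; rewrite mulSn; lia.
  have := hz _ im.
  rewrite /block_event_set leq_addr mulSn addnC ltn_add2r iL addnK /block_set.
  by case: ifP => _ /=; rewrite in_itv /= ?add0r => /andP[? ?]; split=> //; lra.
Qed.

(** * Geometric probability bound and conclusion *)

Lemma measurable_hankel {d : measure_display} {T : measurableType d}
    {R : realType} {P : probability T R} (z : nat -> {RV P >-> R}) (L N : nat)
    (i : 'I_L) (j : 'I_(N - L + 1)) :
  measurable_fun setT (fun w => hankel L N (fun k => z k w) i j).
Proof. by under eq_fun do rewrite mxE; exact: measurable_funPT. Qed.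

Lemma fine_probability_le1 {d : measure_display} {T : measurableType d}
    {R : realType} (P : probability T R) (A : set T) :
  measurable A -> fine (P A) <= 1.
Proof.
by move=> mA; rewrite -lee_fin fineK ?fin_num_measure// probability_le1.
Qed.

(** Here [q] is the failure probability of a single block, the same for all [m] and [N]; [m]
    independent failures have probability [q ^+ m]. *)
Lemma prob_lambda_min_hankel_ge {d : measure_display} {T : measurableType d}
    {R : realType} {P : probability T R} (z : nat -> {RV P >-> R}) (L : nat)
    (a : R) : 0 < a ->
  mutually_independent z -> (forall i, standard_normal (z i)) ->
  exists2 q : R, 0 <= q < 1 & forall m N, (m.+1 * L.*2.+1 <= N)%N ->
  1 - q ^+ m <= fine (P [set w |
    let H := hankel L.+1 N (fun k => z k w) in
    a ^+ 2 <= lambda_min (H *m H^T)]).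
Proof.
move=> a0 zI zN.
set K := L.+1%:R * (a + 1).
have K0 : 0 <= K by rewrite mulr_ge0 ?ler0n//; lra.
pose pK := \prod_(i < L.*2.+1) fine (normal_prob 0 1 (block_set L K i)).
have pK0 : 0 < pK by exact: block_prob_gt0.
have mC := @measurable_block_event_set R L K.
have pE m b : (b < m)%N ->
    fine (P (box z (m * L.*2.+1) (block_event_set L K b))) = pK.
  by move=> bm; exact: fine_prob_block.
(* [pK] is itself the probability of a block event, read off with [m = 1] and [b = 0]. *)
have pK1 : pK <= 1.
  rewrite -(pE 1%N 0%N)//; apply: fine_probability_le1.
  exact: measurable_box.
exists (1 - pK) => [|m N mN]; first by lra.
set E := [set w | _].
have mE : measurable E.
  apply: measurable_lambda_min_ge => i j; exact: measurable_hankel.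
(* All [m] blocks fail; the trivial box, of probability 1, is the starting [B] of the induction. *)
pose F := box z (m * L.*2.+1) (fun=> setT) `&`
  \bigcap_(b in `I_m) ~` box z (m * L.*2.+1) (block_event_set L K b).
have mF : measurable F.
  apply: measurableI; first exact: measurable_box.
  apply: fin_bigcap_measurable; first exact: finite_II.
  by move=> b _; apply: measurableC; exact: measurable_box.
have FE : fine (P F) = (1 - pK) ^+ m.
  rewrite fine_prob_boxI_none//; last 2 first.
  - by move=> b b' i; exact: block_event_set_disj.
  - by move=> b i _; left.
  rewrite fine_prob_box// big1 ?mul1r => [|i _]; last first.
    by rewrite preimage_setT probability_setT.
  rewrite (eq_bigr (fun=> 1 - pK)) => [|b _]; last by rewrite pE.
  by rewrite prodr_const card_ord.
have FCE : ~` F `<=` E.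
  move=> w; rewrite /F /box => /= nF.
  apply: contrapT => nE; apply: nF; split=> // b /= bm zb; apply: nE.
  exact: (lambda_min_hankel_block _ _ a0 bm mN zb).
have : (P (~` F) <= P E)%E by apply: le_measure => //; rewrite inE//; exact: measurableC.
rewrite probability_setC// -(fineK (fin_num_measure P _ mF)) FE.
by rewrite -{1}(fineK (fin_num_measure P _ mE)) -EFinB lee_fin.
Qed.

Theorem theorem4 (d : measure_display) (T : measurableType d) (R : realType)
  (P : probability T R) (z : nat -> {RV P >-> R}) (L : nat) :
  (0 < L)%N ->
  mutually_independent z ->
  (forall i, standard_normal (z i)) ->
  exists eps : nat -> R,
    (forall N, 0 < eps N) /\ eps @ \oo --> 0 /\
    (fun N => P [set w : T |
        (inv_ext (sigma_min (hankel L N (fun k => z k w))) <= (eps N)%:E)%E])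
      @ \oo --> 1%E.
Proof.
case: L => // L _ zI zN.
pose Ev (e : R) (N : nat) : set T := [set w : T |
  (inv_ext (sigma_min (hankel L.+1 N (fun k => z k w))) <= e%:E)%E].
have EvE (e : R) N : 0 < e -> Ev e N = [set w |
    let H := hankel L.+1 N (fun k => z k w) in
    e^-1 ^+ 2 <= lambda_min (H *m H^T)].
  by move=> e0; apply/seteqP; split=> w; rewrite /Ev /= inv_ext_sigma_min_le// exprVn.
have mEv (e : R) N : 0 < e -> measurable (Ev e N).
  move=> e0; rewrite EvE//; apply: measurable_lambda_min_ge => i j.
  exact: measurable_hankel.
have p1 (e : R) N : 0 < e -> fine (P (Ev e N)) <= 1.
  by move=> e0; apply: fine_probability_le1; exact: mEv.
have [|eps [eps0 epsc epsP]] :=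
    @cvg_diagonal R (fun e N => fine (P (Ev e N))) p1.
  move=> e e0; have ei0 : 0 < e^-1 by rewrite invr_gt0.
  have [q /andP[q0 q1] qP] := prob_lambda_min_hankel_ge z L _ ei0 zI zN.
  (* This exponent is the largest [m] with [(m+1)(2L+1) <= N], once [N >= 2L+1]. *)
  apply: (@squeeze_cvgr _ _ _ _ (fun N => 1 - q ^+ (N %/ L.*2.+1).-1) (fun=> 1)).
  - exists L.*2.+1 => // N /= LN; rewrite p1// andbT EvE//; apply: qP.
    by rewrite prednK ?divn_gt0//; exact: leq_trunc_div.
  - rewrite -[X in _ --> X]subr0; apply: cvgB; first exact: cvg_cst.
    apply: (@cvg_comp _ _ _ (fun N => (N %/ L.*2.+1).-1) (GRing.exp q) _ \oo).
      move=> A [k _ kA]; exists (k.+1 * L.*2.+1)%N => // N /= kN; apply: kA => /=.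
      by rewrite -ltnS prednK ?divn_gt0 ?leq_divRL//; nia.
    by apply: cvg_expr; rewrite ger0_norm.
  - exact: cvg_cst.
exists eps; split => //; split => //.
rewrite (_ : (fun _ => _) = fun N => (fine (P (Ev (eps N) N)))%:E).
  by apply: cvg_EFin => //; exact: nearW.
by apply/funext => N; rewrite fineK// fin_num_measure//; exact: mEv.
Qed.
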